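(* Let $L\ge S\ge 1$ be integers, let $\beta\in(0,1)$ be the positive root of $S\beta^2+L\beta=1$, and let $(\xi_{L,S}^n)_{n\in\mathbb N}$ be the classical $LS$-sequence of points (defined in the context). Put $$\tau_1=\frac{-L-2S+\sqrt{L^2+4S}}{2\sqrt{L^2+4S}},\qquad \lambda_1=\frac{-L+\sqrt{L^2+4S}}{2\sqrt{L^2+4S}},$$ $$\tilde R=\max\{|\tau_1|,\,|\tau_1+(L+S-2)\lambda_1|\},\qquad B=(2L+S-2)\left(\frac{\tilde R}{1-S\beta}+1\right)+2 .$$ Then for every integer $N\ge 1$ $$D_N(\xi_{L,S}^{1},\xi_{L,S}^{2},\ldots,\xi_{L,S}^{N})\le \frac{\log N}{N|\log\beta|}\,(2L+S-2)\left(\frac{\tilde R}{1-S\beta}+1\right)+\frac BN .$$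
   Context: Discrepancy: for $x_1,\dots,x_N\in[0,1]$, $$D_N(x_1,\dots,x_N)=\sup_{0\le a<b\le 1}\left|\frac1N\sum_{n=1}^N\mathbf 1_{[a,b)}(x_n)-(b-a)\right|.$$ Classical $LS$-sequence of points. Define integer sequences by $l_0=1$, $s_0=0$ and, for $n\ge1$, $l_n=Ll_{n-1}+s_{n-1}$, $s_n=Sl_{n-1}$; put $t_n=l_n+s_n$ (so $t_0=1$). (Here $t_n$, $l_n$, $s_n$ are the total number of intervals, the number of intervals of length $\beta^n$ and the number of intervals of length $\beta^{n+1}$ in the partition of $[0,1)$ obtained from $\{[0,1)\}$ by $n$ times subdividing all intervals of maximal length homothetically into $L$ intervals of relative length $\beta$ followed by $S$ intervals of relative length $\beta^2$.) Every integer $N\ge1$ gets digits $(\epsilon_i,\eta_i)_{0\le i\le n}$ as follows. Let $n$ be such that $t_n\le N<t_{n+1}$, put $N_n=N$, $\epsilon_n=1$, $\eta_n=\lfloor (N-t_n)/l_n\rfloor$. For $m=n-1,n-2,\dots,0$ put $N_m=N_{m+1}-\epsilon_{m+1}t_{m+1}-\eta_{m+1}l_{m+1}$; if $N_m<t_m$ put $\epsilon_m=\eta_m=0$, otherwise put $\epsilon_m=1$ and $\eta_m=\lfloor (N_m-t_m)/l_m\rfloor$. Then $N=\sum_{i=0}^n(\epsilon_it_i+\eta_il_i)$, and $$\xi_{L,S}^N=\sum_{i=0}^n\left(\beta^{i+1}\min\{L,\epsilon_i+\eta_i\}+\beta^{i+2}\max\{\epsilon_i+\eta_i-L,0\}\right).$$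 *)

(* Defs.v *)
From mathcomp Require Import all_boot all_order all_algebra.
From mathcomp Require Import all_classical all_reals all_analysis.

Set Implicit Arguments.
Unset Strict Implicit.
Unset Printing Implicit Defensive.

Import Order.TTheory GRing.Theory Num.Theory.

Section LSCounts.
Local Open Scope nat_scope.
Variables (L S : nat).

(* The pair (l_n, s_n). *)
Fixpoint ls_counts (n : nat) : nat * nat :=
  if n is m.+1 then
    let ls := ls_counts m in (L * ls.1 + ls.2, S * ls.1)
  else (1, 0).

Definition ls_l (n : nat) : nat := (ls_counts n).1.
Definition ls_s (n : nat) : nat := (ls_counts n).2.
Definition ls_t (n : nat) : nat := ls_l n + ls_s n.

(* The n with t_n <= N < t_{n+1}; searching n < N suffices because t_n > n
   (see ls_topP). *)
Definition ls_top (N : nat) : nat :=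
  find (fun n => ls_t n <= N < ls_t n.+1) (iota 0 N).

(* Digits at position m, given the remainder r = N_m. *)
Definition eps_of (m r : nat) : nat := if r < ls_t m then 0 else 1.
Definition eta_of (m r : nat) : nat :=
  if r < ls_t m then 0 else (r - ls_t m) %/ ls_l m.

(* ls_rem N k is N_{n-k}, where n = ls_top N. *)
Fixpoint ls_rem (N k : nat) : nat :=
  if k is j.+1 then
    let m := ls_top N - j in
    let r := ls_rem N j in
    r - eps_of m r * ls_t m - eta_of m r * ls_l m
  else N.

(* epsilon_i and eta_i of N, for 0 <= i <= ls_top N. *)
Definition ls_eps (N i : nat) : nat := eps_of i (ls_rem N (ls_top N - i)).
Definition ls_eta (N i : nat) : nat := eta_of i (ls_rem N (ls_top N - i)).

Lemma ls_l_gt0 n : 0 < L -> 0 < ls_l n.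
Proof.
move=> L_gt0; rewrite /ls_l; elim: n => //= n IHn.
by rewrite addn_gt0 muln_gt0 L_gt0 IHn.
Qed.

Lemma ls_t_ltS n : 0 < L -> 0 < S -> ls_t n < ls_t n.+1.
Proof.
move=> L_gt0 S_gt0; have l_gt0 := ls_l_gt0 n L_gt0.
rewrite [ltnRHS](_ : _ = L * ls_l n + ls_s n + S * ls_l n) // -addn1.
by rewrite leq_add ?leq_add2r ?leq_pmull // muln_gt0 S_gt0.
Qed.

Lemma ls_t_gt n : 0 < L -> 0 < S -> n < ls_t n.
Proof.
move=> L_gt0 S_gt0; elim: n => [//|n IHn].
exact: leq_ltn_trans IHn (ls_t_ltS n L_gt0 S_gt0).
Qed.

Lemma ls_topP N : 0 < L -> 0 < S -> 0 < N ->
  ls_t (ls_top N) <= N < ls_t (ls_top N).+1.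
Proof.
move=> L_gt0 S_gt0 N_gt0; rewrite /ls_top.
set P := (X in find X _).
have hasP : has P (iota 0 N).
  have exT : exists n, N < ls_t n by exists N; exact: ls_t_gt.
  case: (ex_minnP exT) => -[|n] Nlt nmin.
    by move: Nlt N_gt0; rewrite ltnS leqn0 => /eqP ->.
  have tn : ls_t n <= N.
    by rewrite leqNgt; apply/negP => /nmin; rewrite ltnn.
  apply/hasP; exists n; last by rewrite /P tn Nlt.
  by rewrite mem_iota /= add0n (leq_trans (ls_t_gt n L_gt0 S_gt0) tn).
have := nth_find 0 hasP.
by rewrite nth_iota ?add0n // -[X in _ < X](size_iota 0) -has_find.
Qed.

End LSCounts.

Section LSPoints.
Local Open Scope classical_set_scope.
Local Open Scope ring_scope.
Variable R : realType.

(* D_N(x_1, ..., x_N); x 0 is not used. *)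
Definition discrepancy (x : nat -> R) (N : nat) : R :=
  sup [set d : R | exists a b : R, [/\ 0 <= a, a < b, b <= 1 &
    d = `| N%:R^-1 * (\sum_(1 <= n < N.+1) \1_(`[a, b[ : set R) (x n))
           - (b - a) |]].

(* The truncated subtraction of nat renders max{eps_i + eta_i - L, 0}. *)
Definition ls_point (L S : nat) (beta : R) (N : nat) : R :=
  \sum_(i < (ls_top L S N).+1)
    (let d := (ls_eps L S N i + ls_eta L S N i)%N in
     beta ^+ i.+1 * (minn L d)%:R + beta ^+ i.+2 * (d - L)%:R).

Variables (L S : nat).

Definition tau1 : R :=
  (- L%:R - 2 * S%:R + Num.sqrt (L%:R ^+ 2 + 4 * S%:R))
  / (2 * Num.sqrt (L%:R ^+ 2 + 4 * S%:R)).

Definition lambda1 : R :=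
  (- L%:R + Num.sqrt (L%:R ^+ 2 + 4 * S%:R))
  / (2 * Num.sqrt (L%:R ^+ 2 + 4 * S%:R)).

Definition Rtilde : R :=
  Num.max `|tau1| `|tau1 + (L%:R + S%:R - 2) * lambda1|.

Definition Bconst (beta : R) : R :=
  (2 * L%:R + S%:R - 2) * (Rtilde / (1 - S%:R * beta) + 1) + 2.

End LSPoints.

(* Main.v *)
Require Import Defs.
From mathcomp Require Import all_boot all_order all_algebra.
From mathcomp Require Import all_classical all_reals all_analysis.
From mathcomp Require Import ring lra zify.

(* After n subdivisions the left endpoints are the points of index < t_n, the
   first l_n of them belonging to the intervals of length beta^n, and a point of
   index j lies in the level-i interval whose left endpoint has as index the
   remainder N_(i-1) of the digit algorithm for j. Hence the number of points of
   index at most N in an interval of length beta^i takes two consecutive values.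
   As t_m and l_m are combinations of beta^(-m) and (-S beta)^m, it differs from
   N beta^i by at most K + 1, where K = Rtilde / (1 - S beta).

   For x in [0, 1], cut [0, x) greedily into such intervals. A subdivided interval
   of length beta^i contributes at most L - 1 intervals if x lies in a piece of
   length beta^(i+1), and at most L + S - 1 if x lies in a piece of length
   beta^(i+2), which is then left alone by the next subdivision; either way at
   most W = L - 1 + S / 2 per level. With t_n <= N < t_(n+1) the error of
   [0, x) is at most W (K + 1) (n + 1) + 1, and n <= log N / |log beta|. *)

Set Implicit Arguments.
Unset Strict Implicit.
Unset Printing Implicit Defensive.

Import Order.TTheory GRing.Theory Num.Theory.

(** An interval of length [beta^i] splits into pieces of lengths [beta^(i+1)] and [beta^(i+2)], so
    claims about level [i] come from the next two levels, starting where the levels are so fine that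
    the claims are immediate. *)
Lemma down_ind2 (T : nat) (P : nat -> Prop) :
  (forall i, (T <= i)%N -> P i) ->
  (forall i, P i.+1 -> P i.+2 -> P i) -> forall i, P i.
Proof.
move=> PT PS i; move: {2}(T - i)%N (leqnn (T - i)%N) => m.
elim/ltn_ind: m i => -[|m] IH i; first by move=> ?; apply: PT; lia.
by move=> le_m; apply: PS; [apply: (IH m) | apply: (IH m)]; lia.
Qed.

(** * Indices of the intervals and digits of the expansion *)

Section Cells.
Local Open Scope nat_scope.
Variables (L S : nat).
Hypotheses (L_gt0 : 0 < L) (S_gt0 : 0 < S).
Local Notation l := (ls_l L S).
Local Notation t := (ls_t L S).

Lemma ls_lS i : l i.+1 = t i + (L - 1) * l i.
Proof.
have -> : l i.+1 = L * l i + ls_s L S i by [].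
by rewrite /ls_t mulnBl mul1n; have := leq_pmull (l i) L_gt0; lia.
Qed.

Lemma ls_tS i : t i.+1 = t i + (L + S - 1) * l i.
Proof.
rewrite {1}/ls_t ls_lS (_ : ls_s L S i.+1 = S * l i) //.
by rewrite -addnA -mulnDl; congr (_ + _ * _); lia.
Qed.

Lemma ls_l_le_t i : l i <= t i.
Proof. exact: leq_addr. Qed.

Lemma ls_t_leS i : t i <= l i.+1.
Proof. by rewrite ls_lS leq_addr. Qed.

Lemma ls_t_mono i j : i <= j -> t i <= t j.
Proof.
by move/subnK <-; elim: (j - i) => //= m /leq_trans -> //; apply/ltnW/ls_t_ltS.
Qed.

(** One step of the digit algorithm, from [N_i] to [N_(i-1)]; [ls_dig] below is [epsilon_i + eta_i],
    the only combination of the digits that the points depend on. *)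
Definition ls_red (i r : nat) : nat := if r < t i then r else (r - t i) %% l i.

Definition ls_dig (i r : nat) : nat :=
  if r < t i then 0 else ((r - t i) %/ l i).+1.

(* Index, among the points of level i+1, of the left endpoint of the d-th piece
   of the interval of length beta^i with index k. *)
Definition ls_child (i k d : nat) : nat :=
  if d is d'.+1 then t i + d' * l i + k else k.

Lemma ls_red_small i r : r < t i -> ls_red i r = r.
Proof. by rewrite /ls_red => ->. Qed.

Lemma ls_dig_small i r : r < t i -> ls_dig i r = 0.
Proof. by rewrite /ls_dig => ->. Qed.

Lemma ls_red_lt i r : ls_red i r < t i.
Proof.
rewrite /ls_red; case: ifP => // _.
exact: leq_trans (ltn_pmod _ (ls_l_gt0 _ _ L_gt0)) (ls_l_le_t i).
Qed.

Lemma ls_red_dig0 i r : l i <= ls_red i r -> r < t i.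
Proof.
rewrite /ls_red; case: ifP => // _.
by rewrite leqNgt ltn_pmod ?ls_l_gt0.
Qed.

Lemma ls_childK i r : ls_child i (ls_red i r) (ls_dig i r) = r.
Proof.
rewrite /ls_red /ls_dig; case: ltnP => //= ge_r.
by rewrite -addnA -divn_eq subnKC.
Qed.

Lemma ls_red_child i k d : k < l i -> ls_red i (ls_child i k d) = k.
Proof.
move=> lt_k; have lt_kt := leq_trans lt_k (ls_l_le_t i).
case: d => [|d] /=; first by rewrite ls_red_small.
rewrite /ls_red -addnA ltnNge leq_addr /= addKn.
by rewrite modnMDl modn_small.
Qed.

Lemma ls_dig_child i k d : k < l i -> ls_dig i (ls_child i k d) = d.
Proof.
move=> lt_k; have lt_kt := leq_trans lt_k (ls_l_le_t i).
case: d => [|d] /=; first by rewrite ls_dig_small.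
rewrite /ls_dig -addnA ltnNge leq_addr /= addKn.
by rewrite divnMDl ?divn_small ?addn0 // (leq_ltn_trans _ lt_k).
Qed.

Lemma ls_child_lt i k d D : k < l i -> d < D ->
  ls_child i k d < t i + (D - 1) * l i.
Proof.
move=> lt_k lt_d; have lt_kt := leq_trans lt_k (ls_l_le_t i).
case: d lt_d => [|d] /= lt_d; first by rewrite ltn_addr.
have : d.+1 * l i <= (D - 1) * l i by rewrite leq_mul2r; apply/orP; right; lia.
rewrite mulSn; lia.
Qed.

(** Together with [ls_child_short]: the index of a piece alone tells whether it is long or short. *)
Lemma ls_child_long i k d : k < l i -> d < L -> ls_child i k d < l i.+1.
Proof. by move=> lt_k lt_d; rewrite ls_lS; apply: ls_child_lt. Qed.

Lemma ls_child_ltt i k d : k < l i -> d < L + S -> ls_child i k d < t i.+1.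
Proof. by move=> lt_k lt_d; rewrite ls_tS; apply: ls_child_lt. Qed.

Lemma ls_child_short i k d : L <= d -> l i.+1 <= ls_child i k d.
Proof.
move=> le_d; case: d le_d => [|d] /= le_d; first by lia.
have : (L - 1) * l i <= d * l i by rewrite leq_mul2r; apply/orP; right; lia.
rewrite ls_lS; lia.
Qed.

Lemma ls_dig_lt i r D : 0 < D -> r < t i + (D - 1) * l i -> ls_dig i r < D.
Proof.
move=> D_gt0 lt_r; rewrite /ls_dig; case: (ltnP r (t i)) => // le_r.
have : (r - t i) %/ l i < D - 1.
  by rewrite (ltn_divLR _ _ (ls_l_gt0 S i L_gt0)) -(ltn_add2l (t i)) subnKC.
lia.
Qed.

Lemma ls_dig_ltLS i r : r < t i.+1 -> ls_dig i r < L + S.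
Proof. by rewrite ls_tS => ?; apply: ls_dig_lt => //; rewrite addn_gt0 L_gt0. Qed.

Lemma ls_dig_ltL i r : r < l i.+1 -> ls_dig i r < L.
Proof. by rewrite ls_lS => ?; apply: ls_dig_lt. Qed.

Lemma ls_red_eq_child i k r : k < l i -> r < t i.+1 ->
  (ls_red i r == k : nat) = \sum_(0 <= d < L + S) (r == ls_child i k d).
Proof.
move=> lt_k lt_r; have [eq_k|ne_k] := eqVneq (ls_red i r) k.
  have lt_d := ls_dig_ltLS lt_r.
  rewrite (bigD1_seq (ls_dig i r)) /= ?iota_uniq ?mem_index_iota //.
  have -> : ls_child i k (ls_dig i r) = r by rewrite -eq_k ls_childK.
  rewrite eqxx big1 // => d /negP ne_d.
  by apply/eqP; rewrite eqb0; apply/eqP => eq_r; case: ne_d; rewrite eq_r ls_dig_child.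
rewrite big1 // => d _; apply/eqP; rewrite eqb0; apply: contra_neq ne_k => ->.
exact: ls_red_child.
Qed.

(** The numbering runs piece by piece, so indices compare lexicographically as pairs of digit and
    remainder. *)
Lemma ls_child_le i k r d : k < l i ->
  (ls_child i k d <= r) =
    (d < ls_dig i r) || (d == ls_dig i r) && (k <= ls_red i r).
Proof.
move=> lt_k; have lt_kt := leq_trans lt_k (ls_l_le_t i).
have l_gt0 := ls_l_gt0 S i L_gt0.
rewrite /ls_dig /ls_red; case: (ltnP r (t i)) => [lt_r|le_r].
  by case: d => [|d] //=; apply/negbTE; lia.
case: d => [|d] /=; first by rewrite (leq_trans (ltnW lt_kt) le_r).
rewrite -addnA -leq_subRL // {1}(divn_eq (r - t i) (l i)).
rewrite ltnS eqSS; set e := _ %/ _; set m := _ %% _.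
have lt_m : m < l i by rewrite ltn_mod.
case: ltngtP => [lt_d|lt_d|->] /=; last by rewrite leq_add2l.
- have : d.+1 * l i <= e * l i by rewrite leq_mul2r lt_d orbT.
  by rewrite mulSn; lia.
- have : e.+1 * l i <= d * l i by rewrite leq_mul2r lt_d orbT.
  by rewrite mulSn => ?; apply/negbTE; lia.
Qed.

Lemma ls_child_count i k r D : 0 < D -> k < l i -> r < t i + (D - 1) * l i ->
  \sum_(0 <= d < D) (ls_child i k d <= r) = ls_dig i r + (k <= ls_red i r).
Proof.
move=> D_gt0 lt_k lt_r; have lt_dig := ls_dig_lt D_gt0 lt_r.
rewrite (@big_cat_nat _ _ _ (ls_dig i r)) ?(ltnW lt_dig) //=.
rewrite [X in _ + X]big_ltn // ls_child_le // ltnn eqxx /=.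
congr (_ + _).
  rewrite (eq_big_nat _ _ (F2 := fun=> 1)); last first.
    by move=> d /= lt_d; rewrite ls_child_le // lt_d.
  by rewrite sum_nat_const_nat muln1 subn0.
rewrite big_nat_cond big1 ?addn0 // => d; rewrite andbT => /andP[lt_d _].
by rewrite ls_child_le // ltnNge (ltnW lt_d) /= gtn_eqF.
Qed.

(** * Ancestors of a point across the levels *)

Fixpoint ls_reduce (e i j : nat) : nat :=
  if e is e'.+1 then ls_red i (ls_reduce e' i.+1 j) else j.

(* Index of the left endpoint of the level-i interval containing the point of
   index j, i.e. N_(i-1) in the digit algorithm for N = j; j steps suffice
   because j < t_(i+j). *)
Definition ls_anc (i j : nat) : nat := ls_reduce j i j.

(** The added innermost reduction, at level [i + e], fixes [j]; so the number of steps in [ls_anc]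
    only has to be large enough. *)
Lemma ls_reduceS e i j : j < t (i + e) -> ls_reduce e.+1 i j = ls_reduce e i j.
Proof.
elim: e i => [|e IH] i lt_j; first by rewrite /= ls_red_small // -(addn0 i).
by rewrite [LHS]/= -/(ls_reduce e.+1 i.+1 j) IH // addSnnS.
Qed.

Lemma ls_ancE i j : ls_anc i j = ls_red i (ls_anc i.+1 j).
Proof.
rewrite /ls_anc -[RHS]/(ls_reduce j.+1 i j) ls_reduceS //.
by apply: (leq_ltn_trans (leq_addl i j)); apply: ls_t_gt.
Qed.

Lemma ls_anc_lt i j : ls_anc i j < t i.
Proof. by rewrite ls_ancE ls_red_lt. Qed.

Lemma ls_anc_small i j : j < t i -> ls_anc i j = j.
Proof.
move=> lt_j; rewrite /ls_anc; elim: {2}j i lt_j => //= e IH i lt_j.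
rewrite IH ?ls_red_small //; exact: ltn_trans lt_j (ls_t_ltS _ L_gt0 S_gt0).
Qed.

(** A short interval is left alone by the next subdivision and keeps its index. *)
Lemma ls_anc_short i j k : l i <= k -> (ls_anc i j == k) = (ls_anc i.+1 j == k) && (k < t i).
Proof.
move=> le_k; rewrite ls_ancE; apply/eqP/andP => [eq_k|[/eqP -> lt_k]].
  have lt_k : ls_anc i.+1 j < t i by apply: ls_red_dig0; rewrite eq_k.
  by rewrite -eq_k ls_red_small ?eqxx.
exact: ls_red_small.
Qed.

(** Short pieces are taken two levels down, where they have maximal length; thus the recursion only
    involves intervals of maximal length. *)
Lemma ls_anc_eq_child i k j : k < l i ->
  (ls_anc i j == k : nat) = \sum_(0 <= d < L) (ls_anc i.+1 j == ls_child i k d)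
    + \sum_(0 <= d < S) (ls_anc i.+2 j == ls_child i k (L + d)).
Proof.
move=> lt_k; rewrite ls_ancE ls_red_eq_child ?ls_anc_lt //.
rewrite (@big_cat_nat _ _ _ L) ?leq_addr //=; congr (_ + _).
rewrite -{1}(add0n L) big_addn addKn; apply: eq_big_nat => d /= lt_d.
by rewrite addnC ls_anc_short ?ls_child_short ?leq_addr // ls_child_ltt ?ltn_add2l // andbT.
Qed.

(** A digit of at least [L] places the ancestor at level [i+1] in a short interval, which is not
    subdivided next, so the following digit vanishes. *)
Lemma ls_dig_ge_L i j : L <= ls_dig i (ls_anc i.+1 j) ->
  ls_dig i.+1 (ls_anc i.+2 j) = 0.
Proof.
move=> le_L; apply: ls_dig_small; apply: ls_red_dig0.
rewrite -ls_ancE leqNgt; apply/negP => /ls_dig_ltL.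
by rewrite ltnNge le_L.
Qed.

(** If [anc i.+2 j < t i.+1], all [L + S] children are compared with one and the same index.
    Otherwise every short child lies below [anc i.+2 j], while [anc i.+1 j < l i.+1] leaves only
    long children to count. *)
Lemma ls_anc_children_count i k j : k < l i ->
  \sum_(0 <= d < L) (ls_child i k d <= ls_anc i.+1 j)
    + \sum_(0 <= d < S) (ls_child i k (L + d) <= ls_anc i.+2 j) =
  S * (0 < ls_dig i.+1 (ls_anc i.+2 j)) + ls_dig i (ls_anc i.+1 j)
    + (k <= ls_anc i j).
Proof.
move=> lt_k; rewrite (ls_ancE i).
have lt_ch d : d < S -> ls_child i k (L + d) < t i.+1.
  by move=> lt_d; rewrite ls_child_ltt // ltn_add2l.
have [lt_t|le_t] := ltnP (ls_anc i.+2 j) (t i.+1).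
  rewrite ls_dig_small // muln0 add0n -(@ls_child_count _ _ _ (L + S)) //; last first.
  - by rewrite -ls_tS ls_anc_lt.
  - by rewrite addn_gt0 L_gt0.
  rewrite [RHS](@big_cat_nat _ _ _ L) ?leq_addr //=; congr (_ + _).
  rewrite -{2}(add0n L) big_addn addKn (ls_ancE i.+1) ls_red_small //.
  by apply: eq_bigr => d _; rewrite addnC.
rewrite addnC -addnA; congr (_ + _).
  rewrite /ls_dig (ltnNge (ls_anc _ _)) le_t /= muln1.
  rewrite (eq_big_nat _ _ (F2 := fun=> 1)).
    by rewrite sum_nat_const_nat muln1 subn0.
  by move=> d /= lt_d; rewrite (leq_trans (ltnW (lt_ch _ lt_d)) le_t).
apply: ls_child_count => //; rewrite -ls_lS ls_ancE ltnNge.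
by apply/negP => /ls_red_dig0; rewrite ltnNge le_t.
Qed.

End Cells.

Section Points.
Local Open Scope ring_scope.
Variables (R : realType) (L S : nat) (beta : R).
Hypotheses (S_gt0 : (0 < S)%N) (le_SL : (S <= L)%N).
Hypotheses (beta_gt0 : 0 < beta) (beta_lt1 : beta < 1).
Hypothesis betaE : S%:R * beta ^+ 2 + L%:R * beta = 1.
Local Notation l := (ls_l L S).
Local Notation t := (ls_t L S).
Local Notation red := (ls_red L S).
Local Notation dig := (ls_dig L S).
Local Notation anc := (ls_anc L S).
Local Notation child := (ls_child L S).

Let L_gt0 : (0 < L)%N. Proof. exact: leq_trans S_gt0 le_SL. Qed.

(** * Positions of the left endpoints *)

Definition ls_offset (i d : nat) : R :=
  beta ^+ i.+1 * (minn L d)%:R + beta ^+ i.+2 * (d - L)%:R.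

(** For [r < t i] this is the left endpoint of the level-[i] interval with index [r]. *)
Fixpoint ls_pos (i r : nat) : R :=
  if i is i'.+1 then ls_pos i' (red i' r) + ls_offset i' (dig i' r) else 0.

Lemma ls_offset0 i : ls_offset i 0 = 0.
Proof. by rewrite /ls_offset minn0 sub0n !mulr0 addr0. Qed.

Lemma ls_offset_long i d : (d <= L)%N -> ls_offset i d = beta ^+ i * (d%:R * beta).
Proof.
move=> le_d; rewrite /ls_offset (minn_idPr le_d) (_ : d - L = 0)%N; last by lia.
by rewrite mulr0 addr0 exprS; ring.
Qed.

Lemma ls_offset_short i d :
  ls_offset i (L + d) = beta ^+ i * (L%:R * beta + d%:R * beta ^+ 2).
Proof.
by rewrite /ls_offset (minn_idPl (leq_addr _ _)) addKn !exprS expr0; ring.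
Qed.

Lemma ls_pos_stable i m j : (j < t i)%N -> (i <= m)%N -> ls_pos m j = ls_pos i j.
Proof.
move=> lt_j /subnK <-; elim: (m - i)%N => //= e IH.
have lt_j' : (j < t (e + i))%N.
  by apply: leq_trans lt_j _; apply: ls_t_mono => //; apply: leq_addl.
by rewrite ls_red_small // ls_dig_small // ls_offset0 addr0.
Qed.

Lemma ls_pos_child i k d : (k < l i)%N ->
  ls_pos i.+1 (child i k d) = ls_pos i k + ls_offset i d.
Proof. by move=> lt_k; rewrite /= ls_red_child // ls_dig_child. Qed.

Lemma ls_pos_child_short i k d : (k < l i)%N -> (d < S)%N ->
  ls_pos i.+2 (child i k (L + d)) = ls_pos i k + ls_offset i (L + d).
Proof.
move=> lt_k lt_d; rewrite -ls_pos_child //; apply: ls_pos_stable => //.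
by apply: ls_child_ltt => //; rewrite ltn_add2l.
Qed.

Lemma ls_pointE j : (0 < j)%N -> ls_point L S beta j = ls_pos j j.
Proof.
move=> j_gt0; set T := ls_top L S j.
have /andP[_ lt_T] := @ls_topP L S j L_gt0 S_gt0 j_gt0.
have -> : ls_pos j j = ls_pos T.+1 j.
  have lt_j := ls_t_gt j L_gt0 S_gt0.
  rewrite -(@ls_pos_stable j (maxn j T.+1) j) ?leq_maxl //.
  by rewrite (@ls_pos_stable T.+1) ?leq_maxr.
pose D i := (ls_eps L S j i + ls_eta L S j i)%N.
(* After [s] steps the algorithm has split off the [s] leading digits, and the remainder still has
   to be placed. *)
suff pos_sum s : (s <= T.+1)%N -> ls_pos T.+1 j =
    ls_pos (T.+1 - s)%N (ls_rem L S j s)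
      + \sum_(T.+1 - s <= i < T.+1) ls_offset i (D i).
  rewrite (pos_sum T.+1) // subnn add0r big_mkord.
  by apply: eq_bigr.
elim: s => [|s IH] le_s; first by rewrite subn0 big_geq // addr0.
rewrite IH ?(ltnW le_s) // subSS subSn // [ls_pos _.+1 _]/= -addrA; congr (_ + _).
  congr ls_pos; rewrite /= /ls_red /eps_of /eta_of; case: ltnP => [_|le_r].
    by rewrite !mul0n !subn0.
  by rewrite mul1n {2}(divn_eq (_ - _) (l (T - s))) addKn.
rewrite [RHS]big_ltn ?ltnS ?leq_subr //; congr (_ + _); congr ls_offset.
rewrite /D /ls_eps /ls_eta -/T subKn // /ls_dig /eps_of /eta_of.
by case: ltnP.
Qed.

(** * Inequalities between [S], [L] and [beta] *)

Lemma rho_lt1 : S%:R * beta ^+ 2 < 1.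
Proof.
have : 0 < L%:R * beta by rewrite mulr_gt0 ?ltr0n.
by move: betaE; lra.
Qed.

(** Here [S <= L] enters: [S beta + S beta^2 <= L beta + S beta^2 = 1]. *)
Lemma Sbeta_le : S%:R * beta * (1 + beta) <= 1.
Proof.
have : S%:R * beta <= L%:R * beta by rewrite ler_pM2r // ler_nat.
by move: betaE; lra.
Qed.

Lemma Sbeta_gt0 : 0 < S%:R * beta.
Proof. by rewrite mulr_gt0 ?ltr0n. Qed.

Lemma Sbeta_lt1 : S%:R * beta < 1.
Proof. by have := Sbeta_le; have := mulr_gt0 Sbeta_gt0 beta_gt0; lra. Qed.

Lemma beta_sqr_le : beta + beta ^+ 2 <= 1.
Proof.
have le1 : 1 <= S%:R :> R by rewrite ler1n.
have := Sbeta_le; have := mulr_gt0 beta_gt0 beta_gt0.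
by move: beta_gt0 => b0 bb h; nra.
Qed.

(** Descends to the piece holding the point, at level [i+1] if it is long and [i+2] if it is short;
    from level [j] on the point is itself the left endpoint. *)
Lemma ls_cell i j k : (k < l i)%N -> anc i j = k ->
  ls_pos i k <= ls_pos j j < ls_pos i k + beta ^+ i.
Proof.
move: i k; apply: (@down_ind2 j (fun i => forall k, _ -> _ -> _)) =>
  [i le_j k lt_k|i IH1 IH2 k lt_k eq_k].
  have lt_j := ls_t_gt j L_gt0 S_gt0.
  rewrite ls_anc_small ?(leq_trans lt_j) ?ls_t_mono // => <-.
  by rewrite (ls_pos_stable lt_j) // lexx ltrDl exprn_gt0.
pose d := dig i (anc i.+1 j).
have eq_r : child i k d = anc i.+1 j by rewrite -eq_k ls_ancE // ls_childK.
have lt_d : (d < L + S)%N by apply: ls_dig_ltLS => //; apply: ls_anc_lt.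
have bi_gt0 : 0 < beta ^+ i by rewrite exprn_gt0.
have [lt_dL|le_Ld] := ltnP d L.
  have := IH1 _ (ls_child_long L_gt0 S_gt0 lt_k lt_dL) (esym eq_r).
  rewrite ls_pos_child // ls_offset_long ?(ltnW lt_dL) // exprS => /andP[le1 lt1].
  have le_dL : (d.+1)%:R <= L%:R :> R by rewrite ler_nat.
  have := betaE; have := mulr_gt0 Sbeta_gt0 beta_gt0.
  move: le_dL; rewrite -natr1 => h1 h2 h3.
  have d0 : 0 <= d%:R * beta by rewrite mulr_ge0 // ltW.
  apply/andP; split; first by apply: le_trans le1; rewrite lerDl mulr_ge0 // ltW.
  apply: lt_le_trans lt1 _.
  rewrite -addrA lerD2l -(mulrC (beta ^+ i)) -mulrDr ger_pMr //.
  have : (d%:R + 1) * beta <= L%:R * beta by rewrite ler_pM2r.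
  lra.
have [e eq_d] : exists e, d = (L + e)%N by exists (d - L)%N; rewrite subnKC.
have lt_e : (e < S)%N by move: lt_d; rewrite eq_d ltn_add2l.
have eq_r2 : anc i.+2 j = child i k d.
  apply/eqP; move/eqP: (esym eq_r).
  by rewrite ls_anc_short ?ls_child_short // => /andP[].
have lt_ch : (child i k d < l i.+2)%N.
  by apply: leq_trans (ls_t_leS L_gt0 S_gt0 _); apply: ls_child_ltt.
have := IH2 _ lt_ch eq_r2.
rewrite eq_d ls_pos_child_short // ls_offset_short => /andP[le1 lt1].
have le_eS : (e.+1)%:R <= S%:R :> R by rewrite ler_nat.
move: le_eS; rewrite -natr1 => h1.
have b2 : 0 < beta ^+ 2 by rewrite exprn_gt0.
have e0 : 0 <= e%:R * beta ^+ 2 by rewrite mulr_ge0 // ltW.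
have L0 : 0 <= L%:R * beta by rewrite mulr_ge0 // ltW.
apply/andP; split.
  by apply: le_trans le1; rewrite lerDl mulr_ge0 ?addr_ge0 // ltW.
apply: lt_le_trans lt1 _.
rewrite -addrA lerD2l -(addn2 i) exprD -mulrDr ger_pMr //.
have : (e%:R + 1) * beta ^+ 2 <= S%:R * beta ^+ 2 by rewrite ler_pM2r.
by move: betaE; lra.
Qed.

(** * Closed forms and bounds for the numbers of intervals *)

Lemma ls_lE i : beta ^+ i * (l i)%:R =
  (1 + S%:R * beta ^+ 2 * (- (S%:R * beta ^+ 2)) ^+ i) / (1 + S%:R * beta ^+ 2).
Proof.
set rho := S%:R * _.
have rho_gt0 : 0 < 1 + rho by rewrite addr_gt0 // mulr_gt0 ?exprn_gt0 ?ltr0n.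
(* The first identity says that the intervals of level [m] have total length 1; it turns the
   recursion for [l] into an affine one of ratio [- rho]. *)
have lsE m : beta ^+ m.+1 * (ls_s L S m)%:R = 1 - beta ^+ m * (l m)%:R /\
    beta ^+ m.+1 * (l m.+1)%:R = 1 - rho * (beta ^+ m * (l m)%:R).
  elim: m => [|m [IH1 IH2]].
    split; first by rewrite /ls_s /ls_l /=; ring.
    by rewrite /ls_l /= muln1 addn0 expr1 expr0 !mulr1 /rho; move: betaE; lra.
  have sE : beta ^+ m.+2 * (ls_s L S m.+1)%:R = 1 - beta ^+ m.+1 * (l m.+1)%:R.
    rewrite IH2 (_ : ls_s L S m.+1 = (S * l m)%N) // natrM /rho !exprS; ring.
  split=> //; rewrite (_ : l m.+2 = (L * l m.+1 + ls_s L S m.+1)%N) // natrD natrM.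
  rewrite mulrDr sE.
  rewrite (_ : beta ^+ m.+2 * _ = L%:R * beta * (beta ^+ m.+1 * (l m.+1)%:R)); last first.
    by rewrite [beta ^+ m.+2]exprS; ring.
  have -> : L%:R * beta = 1 - rho by move: betaE; rewrite /rho; lra.
  ring.
elim: i => [|i IH]; first by rewrite /ls_l /= !expr0 !mulr1 divff // gt_eqF.
have [_ ->] := lsE i; rewrite IH [(- rho) ^+ i.+1]exprS.
by field; rewrite gt_eqF.
Qed.

Lemma ls_tE i : beta ^+ i * (t i)%:R =
  beta ^+ i * (l i)%:R + (1 - beta ^+ i * (l i)%:R) / beta.
Proof.
have b0 : beta != 0 by rewrite gt_eqF.
have b20 : 1 + S%:R * beta ^+ 2 != 0.
  by rewrite gt_eqF // addr_gt0 // mulr_gt0 ?exprn_gt0 ?ltr0n.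
have: beta ^+ i.+1 * (l i.+1)%:R = 1 - S%:R * beta ^+ 2 * (beta ^+ i * (l i)%:R).
  by rewrite !ls_lE [(- _) ^+ i.+1]exprS; field.
rewrite /ls_t natrD mulrDr (_ : l i.+1 = (L * l i + ls_s L S i)%N) // natrD natrM.
move=> h; congr (_ + _); apply: (mulIf b0); rewrite mulfVK //.
have -> : beta ^+ i * (ls_s L S i)%:R * beta =
  beta ^+ i.+1 * (L%:R * (l i)%:R + (ls_s L S i)%:R) - L%:R * beta * (beta ^+ i * (l i)%:R).
  by rewrite exprS; ring.
rewrite h; have -> : L%:R * beta = 1 - S%:R * beta ^+ 2 by move: betaE; lra.
ring.
Qed.

Lemma ls_l_le1 i : beta ^+ i * (l i)%:R <= 1.
Proof.
have : 0 <= (1 - beta ^+ i * (l i)%:R) / beta.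
  have := ls_tE i; rewrite /ls_t natrD mulrDr => /addrI <-.
  by rewrite mulr_ge0 // exprn_ge0 // ltW.
by rewrite pmulr_lge0 ?invr_gt0 // subr_ge0.
Qed.

Lemma ls_t_ge1 i : 1 <= beta ^+ i * (t i)%:R.
Proof.
rewrite ls_tE -lerBlDl ler_pdivlMr //.
by rewrite ler_piMr ?subr_ge0 ?ls_l_le1 // ltW.
Qed.

(** The left side is [1 + (1 - X) (1 / beta - 1)] with [X = beta^i l_i], and [1 - X <= S beta^2]. *)
Lemma ls_t_le i : beta ^+ i * (t i)%:R <= 1 + S%:R * beta * (1 - beta).
Proof.
set X := beta ^+ i * (l i)%:R.
have : 1 - X <= S%:R * beta ^+ 2.
  rewrite {}/X; case: i => [|i].
    by rewrite expr0 mul1r subrr mulr_ge0 // exprn_ge0 // ltW.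
  have -> : 1 - beta ^+ i.+1 * (l i.+1)%:R = S%:R * beta ^+ 2 * (beta ^+ i * (l i)%:R).
    rewrite !ls_lE [(- _) ^+ i.+1]exprS; field.
    by rewrite gt_eqF // addr_gt0 // mulr_gt0 ?exprn_gt0 ?ltr0n.
  by rewrite ger_pMr ?ls_l_le1 // mulr_gt0 ?exprn_gt0 ?ltr0n.
move=> le_X; rewrite ls_tE -/X.
rewrite -lerBrDl ler_pdivrMr //.
have := mulr_gt0 Sbeta_gt0 beta_gt0.
move: le_X beta_lt1 beta_gt0; rewrite expr2; nra.
Qed.

(** * Counting the points of index at most [N] in an interval *)

Variable N : nat.

(** Index 0, the point 0, is included although the sequence starts at index 1; [ls_interval_err]
    accounts for it. *)
Definition ls_cell_sum (i k : nat) (F : nat -> R) : R :=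
  \sum_(0 <= j < N.+1) (anc i j == k)%:R * F j.

Lemma ls_cell_sum_children i k F : (k < l i)%N ->
  ls_cell_sum i k F = \sum_(0 <= d < L) ls_cell_sum i.+1 (child i k d) F
    + \sum_(0 <= d < S) ls_cell_sum i.+2 (child i k (L + d)) F.
Proof.
move=> lt_k; rewrite /ls_cell_sum.
rewrite [X in _ = X + _]exchange_big [X in _ = _ + X]exchange_big -big_split /=.
apply: eq_bigr => j _; rewrite ls_anc_eq_child // natrD mulrDl !natr_sum.
by rewrite !mulr_suml.
Qed.

Lemma ls_cell_sum_small i k F : (N < t i)%N ->
  ls_cell_sum i k F = (k <= N)%:R * F k.
Proof.
move=> lt_N; rewrite /ls_cell_sum (eq_big_nat _ _ (F2 := fun j => (j == k)%:R * F j)); last first.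
  move=> j /andP[_]; rewrite ltnS => le_j; rewrite ls_anc_small //.
  exact: leq_ltn_trans le_j lt_N.
have [le_k|lt_k] := leqP k N.
  rewrite (bigD1_seq k) ?iota_uniq ?mem_index_iota ?ltnS //= eqxx !mul1r.
  by rewrite big1 ?addr0 // => j /negbTE ->; rewrite mul0r.
rewrite big_nat_cond big1 ?mul0r // => j; rewrite andbT ltnS => /andP[_ le_j].
by rewrite ltn_eqF ?mul0r // (leq_ltn_trans le_j).
Qed.

Let dg i := dig i (anc i.+1 N).

(* (1 + S beta^2) (eps_i tau_1 + eta_i lambda_1), for the digits of N. *)
Definition ls_excess (i : nat) : R :=
  if dg i == 0%N then 0 else - (S%:R * beta * (1 - beta * (dg i)%:R)).

(** The sum of [(- S beta)^(m - i) ls_excess m] over [i <= m < i + e]. For [ys] it stops at level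
    [N], from which on all digits vanish. *)
Fixpoint ls_excess_tail (e i : nat) : R :=
  if e is e'.+1 then ls_excess i - S%:R * beta * ls_excess_tail e' i.+1 else 0.

Let ys i := ls_excess_tail (N - i) i.

Lemma ls_dg_large i : (N <= i)%N -> dg i = 0%N.
Proof.
move=> le_N; have lt_N : (N < t i)%N.
  exact: leq_trans (ls_t_gt N L_gt0 S_gt0) (ls_t_mono L_gt0 S_gt0 le_N).
rewrite /dg ls_anc_small ?ls_dig_small //.
exact: ltn_trans lt_N (ls_t_ltS i L_gt0 S_gt0).
Qed.

Lemma ls_excess_tailE i : ys i = ls_excess i - S%:R * beta * ys i.+1.
Proof.
rewrite /ys; have [lt_i|le_N] := ltnP i N; first by rewrite -[in LHS](subnSK lt_i).
have -> : (N - i = 0)%N by lia.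
have -> : (N - i.+1 = 0)%N by lia.
by rewrite /= /ls_excess ls_dg_large //= !mulr0 subr0.
Qed.

(* Every interval of length beta^i contains [ls_mean i] or [ls_mean i + 1] of
   the points of index at most N, see [ls_cell_sum1]. *)
Definition ls_mean (i : nat) : R :=
  N%:R * beta ^+ i
  + (1 - (- (S%:R * beta ^+ 2)) ^+ i) / (1 + S%:R * beta ^+ 2) * ys i
  - (anc i N)%:R * beta ^+ i.

Lemma ls_anc_stepE i : (anc i.+1 N)%:R * beta ^+ i =
  (anc i N)%:R * beta ^+ i + (if dg i == 0%N then 0 else
    beta ^+ i * (t i)%:R + ((dg i)%:R - 1) * (beta ^+ i * (l i)%:R)).
Proof.
rewrite -{1}(ls_childK L S i (anc i.+1 N)) -ls_ancE // -/(dg i).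
case: (dg i) => [|d] /=; first by rewrite addr0.
by rewrite -natr1 !natrD natrM; ring.
Qed.

(** The last summand is the digit part of [ls_anc_children_count]. Once everything is written
    through [beta^i], [(- S beta^2)^i] and the tail from [i+2] on, this is a rational identity for
    each pattern of zero and nonzero digits. *)
Lemma ls_meanE i : ls_mean i = L%:R * ls_mean i.+1 + S%:R * ls_mean i.+2
  + (S * (0 < dg i.+1) + dg i)%:R.
Proof.
rewrite /ls_mean (ls_excess_tailE i) (ls_excess_tailE i.+1).
have b0 : beta != 0 by rewrite gt_eqF.
have b20 : 1 + S%:R * beta ^+ 2 != 0.
  by rewrite gt_eqF // addr_gt0 // mulr_gt0 ?exprn_gt0 ?ltr0n.
have LE : L%:R = (1 - S%:R * beta ^+ 2) / beta.
  by apply: (mulIf b0); rewrite mulfVK //; move: betaE; lra.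
have e1 := ls_anc_stepE i; have e2 := ls_anc_stepE i.+1.
have tE := ls_tE i; have tE' := ls_tE i.+1.
rewrite !ls_lE in tE tE'.
rewrite tE ls_lE in e1; rewrite tE' ls_lE in e2.
have -> : (anc i.+2 N)%:R * beta ^+ i.+2 = beta * ((anc i.+2 N)%:R * beta ^+ i.+1).
  by rewrite [beta ^+ i.+2]exprS; ring.
rewrite e2.
have -> : (anc i.+1 N)%:R * beta ^+ i.+1 = beta * ((anc i.+1 N)%:R * beta ^+ i).
  by rewrite [beta ^+ i.+1]exprS; ring.
rewrite e1 {e1 e2 tE tE'} /ls_excess natrD natrM LE.
rewrite ![(- _) ^+ _.+1]exprS ![beta ^+ _.+1]exprS.
move: (ys i.+2) ((- _) ^+ i) (beta ^+ i) ((anc i N)%:R) => y z bi a.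
move: (dg i) (dg i.+1) => d1 d2.
by case: d1 => [|d1]; case: d2 => [|d2] /=; field; rewrite -expr2 b20.
Qed.

Lemma ls_cell_sum1 i k : (k < l i)%N ->
  ls_cell_sum i k (fun=> 1) = ls_mean i + (k <= anc i N)%:R.
Proof.
move: i k; apply: (@down_ind2 N (fun i => forall k, _ -> _)) => [i le_N k lt_k|i IH1 IH2 k lt_k].
  (* At these levels [ls_mean i] is 0: an interval holds its left endpoint or nothing. *)
  have lt_N : (N < t i)%N.
    exact: leq_trans (ls_t_gt N L_gt0 S_gt0) (ls_t_mono L_gt0 S_gt0 le_N).
  rewrite ls_cell_sum_small // mulr1 ls_anc_small // /ls_mean ls_anc_small //.
  rewrite /ys; have -> : (N - i = 0)%N by lia.
  by rewrite /=; ring.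
have lt_short d : (d < S)%N -> (child i k (L + d) < l i.+2)%N.
  move=> lt_d; apply: leq_trans (ls_t_leS L_gt0 S_gt0 _).
  by apply: ls_child_ltt => //; rewrite ltn_add2l.
rewrite ls_cell_sum_children //.
rewrite (eq_big_nat _ _ (F2 := fun d => ls_mean i.+1 + (child i k d <= anc i.+1 N)%:R)); last first.
  by move=> d /andP[_ lt_d]; apply: IH1; apply: ls_child_long.
rewrite [X in _ + X](eq_big_nat _ _
  (F2 := fun d => ls_mean i.+2 + (child i k (L + d) <= anc i.+2 N)%:R)); last first.
  by move=> d /andP[_ lt_d]; apply: IH2; apply: lt_short.
rewrite big_split [X in _ + X = _]big_split /= !sumr_const_nat !subn0 -!natr_sum.
rewrite -[ls_mean i.+1 *+ _]mulr_natl -[ls_mean i.+2 *+ _]mulr_natl.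
rewrite addrACA -natrD ls_anc_children_count // natrD addrA; congr (_ + _).
by rewrite -ls_meanE.
Qed.

(** * Bounds for the excesses and their alternating tails *)

Lemma ls_excess_ge i : - (S%:R * beta * (1 - beta)) <= ls_excess i.
Proof.
have q0 := Sbeta_gt0.
rewrite /ls_excess; case: eqVneq => [_|ne0].
  by rewrite oppr_le0 mulr_ge0 ?(ltW q0) // subr_ge0 ltW.
by rewrite lerN2 ler_pM2l // lerD2l lerN2 (ler_peMr (ltW beta_gt0)) // ler1n lt0n.
Qed.

Lemma ls_excess_long i : (dg i <= L)%N -> ls_excess i <= 0.
Proof.
move=> le_d; rewrite /ls_excess; case: eqVneq => // _.
rewrite oppr_le0 mulr_ge0 ?(ltW Sbeta_gt0) //.
have : beta * (dg i)%:R <= L%:R * beta by rewrite mulrC ler_pM2r // ler_nat.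
have : 0 < S%:R * beta ^+ 2 by rewrite mulr_gt0 ?exprn_gt0 ?ltr0n.
by move: betaE; lra.
Qed.

(** The largest digit is [L + S - 1]; [Sbeta_le] keeps its excess within the absolute value of that
    of digit 1. *)
Lemma ls_excess_le i : ls_excess i <= S%:R * beta * (1 - beta).
Proof.
have q0 := Sbeta_gt0.
rewrite /ls_excess; case: eqVneq => [_|_].
  by rewrite mulr_ge0 ?(ltW q0) // subr_ge0 ltW.
rewrite -mulrN ler_pM2l //.
have : (dg i < L + S)%N by apply: ls_dig_ltLS => //; apply: ls_anc_lt.
rewrite -(ler_nat R) -(ler_pM2l beta_gt0) -natr1 natrD !mulrDr => h.
have := Sbeta_le; have := mulr_gt0 q0 beta_gt0; have := mulr_gt0 beta_gt0 beta_gt0.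
by move: betaE h; lra.
Qed.

(** A positive excess needs a digit above [L], so [ls_dig_ge_L] applies. *)
Lemma ls_excess_gt0 i : 0 < ls_excess i -> ls_excess i.+1 = 0.
Proof.
move=> gt0; rewrite /ls_excess /dg ls_dig_ge_L // ltnW // ltnNge.
by apply/negP => /ls_excess_long; rewrite leNgt gt0.
Qed.

(* Positive excesses are followed by a vanishing one, and for S = 1 there are
   none; this gains the factor 1 + S beta^2 over the geometric series. *)
Lemma ls_excess_tail_le i :
  `|ys i| <= S%:R * beta * (1 - beta) / ((1 + S%:R * beta ^+ 2) * (1 - S%:R * beta)).
Proof.
have q0 := Sbeta_gt0; have q1 := Sbeta_lt1.
have ge_x := ls_excess_ge; have le_x := ls_excess_le; have gt_x := ls_excess_gt0.
have ysE := ls_excess_tailE.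
have x0 : S = 1%N -> forall i, ls_excess i <= 0.
  move=> S1 m; apply: ls_excess_long.
  have : (dg m < L + S)%N by apply: ls_dig_ltLS => //; apply: ls_anc_lt.
  by rewrite S1 addn1 ltnS.
have ys0 m : (N <= m)%N -> ys m = 0.
  by move=> le_N; rewrite /ys; have -> : (N - m = 0)%N by lia.
set q := S%:R * beta in q0 q1 ge_x le_x ysE *; set g := q * (1 - beta) in ge_x le_x *.
have g0 : 0 <= g by rewrite mulr_ge0 ?(ltW q0) // subr_ge0 ltW.
have -> : S%:R * beta ^+ 2 = q * beta by rewrite /q expr2 mulrA.
have qq : 0 < 1 - q ^+ 2 by rewrite subr_gt0 expr_lt1 // ltW.
have den0 : 0 < (1 + q * beta) * (1 - q).
  by rewrite mulr_gt0 ?subr_gt0 // addr_gt0 // mulr_gt0.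
(* The sum of all [g q^(2m)]: as the weights alternate, excesses of one sign push the tail in a
   given direction at every second level only. *)
pose B := g / (1 - q ^+ 2).
have BE : B * (1 - q ^+ 2) = g by rewrite mulfVK // gt_eqF.
have B0 : 0 <= B by rewrite mulr_ge0 // invr_ge0 ltW.
rewrite ler_pdivlMr // -{}BE in ge_x le_x *.
have qB : 0 <= q * B by rewrite mulr_ge0 // ltW.
have qqB : 0 <= q ^+ 2 * B by rewrite mulr_ge0 // exprn_ge0 // ltW.
have [S1|S_gt1] : S = 1%N \/ (1 < S)%N by case: (S) S_gt0 => [|[|?]] //; [left|right].
  (* The map [y -> x - q y] preserves this interval for every [x] in [[-g, 0]]. *)
  have bnd : - B <= ys i <= q * B.
    move: i; apply: (@down_ind2 N) => [m /ys0 ->|m IH _]; first by rewrite oppr_le0 B0 qB.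
    move: IH => /andP[h1 h2].
    have := x0 S1 m; have := ge_x m; rewrite ysE => h3 h4.
    have := ler_wpM2l (ltW q0) h1; have := ler_wpM2l (ltW q0) h2.
    rewrite mulrN => h5 h6; apply/andP; split; lra.
  have : `|ys i| <= B.
    move/andP: bnd => [h1 h2]; rewrite ler_norml h1 /=; apply: le_trans h2 _.
    by rewrite ler_piMl // ltW.
  move=> le_B; apply: (le_trans (ler_wpM2r (ltW den0) le_B)).
  rewrite ler_wpM2l //.
  have : q * beta <= q by rewrite ler_piMr // ltW.
  nra.
(* For [x <= 0] this interval is preserved as before; for [x > 0] the next excess is 0, and two
   levels are taken at once. *)
have bnd2 : forall m, (- ((1 - q ^+ 2) * B + q * B) <= ys m <= B).
  suff bnd m : (- ((1 - q ^+ 2) * B + q * B) <= ys m <= B) by [].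
  have q2 : q ^+ 2 <= 1 by rewrite -subr_ge0 ltW.
  move: m; apply: (@down_ind2 N) => [m /ys0 ->|m /andP[h1 h2] /andP[h3 h4]].
    by rewrite oppr_le0 B0 addr_ge0 // mulr_ge0 // ltW.
  have h5 := ler_wpM2l (ltW q0) h1; have h6 := ler_wpM2l (ltW q0) h2.
  have h7 := ler_wpM2l (sqr_ge0 q) h3; have h8 := ler_wpM2l (sqr_ge0 q) h4.
  have h9 := ge_x m; have h10 := le_x m.
  have [le0|gt0] := lerP (ls_excess m) 0.
    rewrite ysE; apply/andP; split; first lra.
    have : q * ((1 - q ^+ 2) * B) <= (1 - q ^+ 2) * B.
      by apply: ler_piMl; [rewrite mulr_ge0 // ltW | exact: ltW].
    lra.
  have -> : ys m = ls_excess m + q ^+ 2 * ys m.+2.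
    by rewrite (ysE m) (ysE m.+1) gt_x //; ring.
  have : q ^+ 2 * ((1 - q ^+ 2) * B + q * B) <= (1 - q ^+ 2) * B + q * B.
    by apply: ler_piMl => //; rewrite addr_ge0 // mulr_ge0 // ltW.
  move=> h11; apply/andP; split; lra.
have le_A : `|ys i| <= (1 + q - q ^+ 2) * B.
  move/andP: (bnd2 i) => [h1 h2]; rewrite ler_norml; apply/andP; split; first lra.
  apply: (le_trans h2); rewrite ler_peMl //.
  have : q ^+ 2 <= q by rewrite expr2 ler_piMl // ltW.
  lra.
apply: (le_trans (ler_wpM2r (ltW den0) le_A)).
rewrite [X in _ <= X]mulrC -mulrA [B * _]mulrC mulrA ler_wpM2r //.
have S2 : 2 <= S%:R :> R by rewrite ler_nat.
(* Multiplied by [q], this is what is left of the claim after cancelling [B] and [1 - q]. *)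
have le_b : (1 + q - q ^+ 2) * beta <= q.
  have : (1 + q - q ^+ 2) * beta <= 2 * beta.
    by rewrite ler_pM2r //; nra.
  have : 2 * beta <= q by rewrite ler_pM2r.
  lra.
have -> : 1 - q ^+ 2 = (1 + q) * (1 - q) by ring.
rewrite mulrA ler_pM2r ?subr_gt0 //.
have := ler_wpM2l (ltW q0) le_b; lra.
Qed.

(** * Counting errors of whole and of cut intervals *)

Let K := S%:R * beta * (1 - beta) / ((1 + S%:R * beta ^+ 2) * (1 - S%:R * beta)).

(** By [ls_l_le1] and [ls_t_le], [a beta^i] is at most 1 for [a < l i] and at most 2 for
    [a < t i]. *)
Lemma ls_indic_bound i k a : (k < l i)%N -> (a < t i)%N ->
  `|(k <= a)%:R - a%:R * beta ^+ i| <= 1.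
Proof.
move=> lt_k lt_a; have bi : 0 <= beta ^+ i by rewrite exprn_ge0 // ltW.
have a0 : 0 <= a%:R * beta ^+ i by rewrite mulr_ge0.
rewrite ler_norml; have [le_k|lt_ak] := leqP k a.
  have : a%:R * beta ^+ i <= beta ^+ i * (t i)%:R.
    by rewrite mulrC ler_wpM2l // ler_nat ltnW.
  have := ls_t_le i; have := Sbeta_lt1; have := Sbeta_gt0.
  have := mulr_gt0 Sbeta_gt0 beta_gt0.
  by move=> h1 h2 h3 h4 h5; apply/andP; split=> /=; lra.
have : a%:R * beta ^+ i <= beta ^+ i * (l i)%:R.
  by rewrite mulrC ler_wpM2l // ler_nat ltnW // (ltn_trans lt_ak).
by have := ls_l_le1 i; move=> h1 h2; apply/andP; split=> /=; lra.
Qed.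

Definition ls_cell_err (i k : nat) : R :=
  ls_cell_sum i k (fun=> 1) - N%:R * beta ^+ i.

Lemma ls_cell_err_le i k : (k < l i)%N -> `|ls_cell_err i k| <= K + 1.
Proof.
move=> lt_k; rewrite /ls_cell_err ls_cell_sum1 // /ls_mean.
have rho_gt0 : 0 < S%:R * beta ^+ 2 by rewrite mulr_gt0 ?exprn_gt0 ?ltr0n.
set f := _ / _.
have -> : forall u v w z : R, u + v - w + z - u = v + (z - w) by move=> *; ring.
apply: le_trans (ler_normD _ _) _; apply: lerD; last first.
  by apply: ls_indic_bound => //; apply: ls_anc_lt.
rewrite normrM; apply: le_trans (ls_excess_tail_le i).
(* The factor of [ys i] is at most 1 in absolute value: it is 0 at level 0, and later
   [1 + rho^i <= 1 + rho] with [rho = S beta^2]. *)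
rewrite ler_piMl // normrM normfV (gtr0_norm (addr_gt0 ltr01 rho_gt0)).
rewrite ler_pdivrMr ?addr_gt0 // mul1r.
case: i {lt_k f} => [|i]; first by rewrite expr0 subrr normr0 ltW // addr_gt0.
apply: le_trans (ler_normB _ _) _; rewrite normr1 lerD2l normrX normrN gtr0_norm //.
by rewrite exprS ler_piMr ?(ltW rho_gt0) // exprn_ile1 ?(ltW rho_gt0) ?(ltW rho_lt1).
Qed.

Let below (x : R) (j : nat) : R := (ls_pos j j < x)%R%:R.

Definition ls_part_err (i k : nat) (x : R) : R :=
  ls_cell_sum i k (below x) - N%:R * (x - ls_pos i k).

Lemma ls_cell_sum_full i k x : (k < l i)%N -> ls_pos i k + beta ^+ i <= x ->
  ls_cell_sum i k (below x) = ls_cell_sum i k (fun=> 1).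
Proof.
move=> lt_k le_x; apply: eq_bigr => j _; have [eq_k|_] := eqVneq; last by rewrite !mul0r.
have /andP[_ lt_j] := ls_cell lt_k eq_k.
by rewrite /below (lt_le_trans lt_j le_x).
Qed.

Lemma ls_cell_sum_empty i k x : (k < l i)%N -> x <= ls_pos i k ->
  ls_cell_sum i k (below x) = 0.
Proof.
move=> lt_k le_x; apply: big1 => j _; have [eq_k|_] := eqVneq; last by rewrite !mul0r.
have /andP[le_j _] := ls_cell lt_k eq_k.
by rewrite /below ltNge (le_trans le_x le_j) mulr0.
Qed.

(** Only the left endpoint can be counted; for [x] to its right the count is that of the whole
    interval and just the length shrinks. *)
Lemma ls_part_err_small i k x : (N < t i)%N -> (k < l i)%N ->
  ls_pos i k <= x <= ls_pos i k + beta ^+ i -> `|ls_part_err i k x| <= 1.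
Proof.
move=> lt_N lt_k /andP[le_x ge_x]; rewrite /ls_part_err ls_cell_sum_small // /below.
have := ls_indic_bound lt_k lt_N; rewrite !ler_norml.
have Nx : N%:R * (x - ls_pos i k) <= N%:R * beta ^+ i by rewrite ler_wpM2l // lerBlDl.
have Nx0 : 0 <= N%:R * (x - ls_pos i k) by rewrite mulr_ge0 // subr_ge0.
have [le_k|lt_Nk] := leqP k N => /= /andP[h1 h2]; last by rewrite mul0r; apply/andP; split; lra.
have -> : ls_pos k k = ls_pos i k.
  have lt_ki := leq_trans lt_k (ls_l_le_t L S i); have lt_kk := ls_t_gt k L_gt0 S_gt0.
  rewrite -(@ls_pos_stable k (maxn k i) k) ?leq_maxl //.
  by rewrite (@ls_pos_stable i) ?leq_maxr.
rewrite mul1r; have [lt_x|ge_x'] := ltP (ls_pos i k) x; first by apply/andP; split=> /=; lra.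
have -> : x = ls_pos i k by apply/le_anti; rewrite le_x ge_x'.
by rewrite subrr mulr0 subr0 /=; apply/andP; split; lra.
Qed.

Lemma grid_cell (D : nat) (w u : R) : (0 < D)%N -> 0 <= u <= D%:R * w ->
  exists2 c, (c < D)%N & c%:R * w <= u <= c.+1%:R * w.
Proof.
elim: D => // -[|D] IH _ /andP[u0 le_u]; first by exists 0%N => //; rewrite mul0r u0.
have [le_uD|lt_Du] := leP u (D.+1%:R * w).
  by have [||c lt_c hc] := IH; rewrite ?u0 //; exists c => //; apply: ltnW.
by exists D.+1 => //; rewrite (ltW lt_Du).
Qed.

Lemma big_nat_split_at (D c : nat) (F G : nat -> R) : (c < D)%N ->
  (forall d, (d < c)%N -> F d = G d) -> (forall d, (c < d < D)%N -> F d = 0) ->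
  \sum_(0 <= d < D) F d = \sum_(0 <= d < c) G d + F c.
Proof.
move=> lt_c FG F0; rewrite (@big_cat_nat _ _ _ c) ?(ltnW lt_c) //=.
rewrite [X in _ + X]big_ltn //; congr (_ + _).
  by apply: eq_big_nat => d /andP[_]; apply: FG.
by rewrite big_nat_cond big1 ?addr0 // => d; rewrite andbT; apply: F0.
Qed.

(** The long pieces and the short pieces each form an equidistant grid. Pieces to the left of the
    one containing [x] count fully, those to its right not at all. *)
Lemma ls_part_err_children i k x : (k < l i)%N ->
  ls_pos i k <= x <= ls_pos i k + beta ^+ i ->
  (exists2 c, (c < L)%N &
    ls_pos i.+1 (child i k c) <= x <= ls_pos i.+1 (child i k c) + beta ^+ i.+1 /\
    ls_part_err i k x = \sum_(0 <= d < c) ls_cell_err i.+1 (child i k d)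
      + ls_part_err i.+1 (child i k c) x) \/
  (exists2 c, (c < S)%N &
    ls_pos i.+2 (child i k (L + c)) <= x <= ls_pos i.+2 (child i k (L + c)) + beta ^+ i.+2 /\
    ls_part_err i k x = \sum_(0 <= d < L) ls_cell_err i.+1 (child i k d)
      + \sum_(0 <= d < c) ls_cell_err i.+2 (child i k (L + d))
      + ls_part_err i.+2 (child i k (L + c)) x).
Proof.
move=> lt_k /andP[le_x ge_x].
have bi : 0 < beta ^+ i by rewrite exprn_gt0.
have b1 : 0 < beta ^+ i.+1 by rewrite exprn_gt0.
have b2 : 0 < beta ^+ i.+2 by rewrite exprn_gt0.
have b1E : beta ^+ i.+1 = beta ^+ i * beta by rewrite exprSr.
have b2E : beta ^+ i.+2 = beta ^+ i * beta ^+ 2 by rewrite !exprSr expr0; ring.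
have lt_long d : (d < L)%N -> (child i k d < l i.+1)%N by apply: ls_child_long.
have lt_short d : (d < S)%N -> (child i k (L + d) < l i.+2)%N.
  move=> lt_d; apply: leq_trans (ls_t_leS L_gt0 S_gt0 _).
  by apply: ls_child_ltt => //; rewrite ltn_add2l.
have pos1 d : (d < L)%N -> ls_pos i.+1 (child i k d) = ls_pos i k + d%:R * beta ^+ i.+1.
  by move=> lt_d; rewrite ls_pos_child // ls_offset_long ?(ltnW lt_d) // b1E; ring.
have pos2 d : (d < S)%N -> ls_pos i.+2 (child i k (L + d)) =
    ls_pos i k + L%:R * beta ^+ i.+1 + d%:R * beta ^+ i.+2.
  by move=> lt_d; rewrite ls_pos_child_short // ls_offset_short b1E b2E; ring.
have sumE : L%:R * beta ^+ i.+1 + S%:R * beta ^+ i.+2 = beta ^+ i.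
  rewrite b1E b2E (_ : _ + _ = beta ^+ i * (S%:R * beta ^+ 2 + L%:R * beta)); last by ring.
  by rewrite betaE mulr1.
have [le_u|gt_u] := leP (x - ls_pos i k) (L%:R * beta ^+ i.+1).
  have [|c lt_c /andP[hc1 hc2]] := @grid_cell L (beta ^+ i.+1) (x - ls_pos i k) L_gt0.
    by rewrite subr_ge0 le_x.
  rewrite -natr1 in hc2.
  left; exists c => //; split; first by rewrite pos1 //; apply/andP; split; lra.
  rewrite /ls_part_err ls_cell_sum_children //.
  rewrite (@big_nat_split_at L c _ (fun d => ls_cell_sum i.+1 (child i k d) (fun=> 1))) //.
  - have -> : \sum_(0 <= d < S) ls_cell_sum i.+2 (child i k (L + d)) (below x) = 0.
      rewrite big_nat_cond big1 // => d; rewrite andbT => /andP[_ lt_d].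
      apply: ls_cell_sum_empty; first exact: lt_short.
      by rewrite pos2 //; have := mulr_ge0 (ler0n R d) (ltW b2); lra.
    rewrite addr0 /ls_cell_err sumrB sumr_const_nat subn0 -[X in _ = _ - X + _]mulr_natl pos1 //.
    by ring.
  - move=> d lt_d; have lt_dL := ltn_trans lt_d lt_c.
    apply: ls_cell_sum_full; first exact: lt_long.
    have : d.+1%:R * beta ^+ i.+1 <= c%:R * beta ^+ i.+1 by rewrite ler_pM2r // ler_nat.
    by rewrite pos1 // -natr1; lra.
  - move=> d /andP[lt_d lt_dL]; apply: ls_cell_sum_empty; first exact: lt_long.
    have : c.+1%:R * beta ^+ i.+1 <= d%:R * beta ^+ i.+1 by rewrite ler_pM2r // ler_nat.
    by rewrite pos1 // -natr1; lra.
have [|c lt_c /andP[hc1 hc2]] :=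
    @grid_cell S (beta ^+ i.+2) (x - ls_pos i k - L%:R * beta ^+ i.+1) S_gt0.
  by apply/andP; split; lra.
rewrite -natr1 in hc2.
right; exists c => //; split; first by rewrite pos2 //; apply/andP; split; lra.
rewrite /ls_part_err ls_cell_sum_children //.
rewrite (eq_big_nat _ _ (F2 := fun d => ls_cell_sum i.+1 (child i k d) (fun=> 1))); last first.
  move=> d /andP[_ lt_d]; apply: ls_cell_sum_full; first exact: lt_long.
  have : d.+1%:R * beta ^+ i.+1 <= L%:R * beta ^+ i.+1 by rewrite ler_pM2r // ler_nat.
  by rewrite pos1 // -natr1; lra.
rewrite (@big_nat_split_at S c _ (fun d => ls_cell_sum i.+2 (child i k (L + d)) (fun=> 1))) //.
- rewrite /ls_cell_err !sumrB !sumr_const_nat !subn0.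
  rewrite -[N%:R * beta ^+ i.+1 *+ L]mulr_natl -[N%:R * beta ^+ i.+2 *+ c]mulr_natl pos2 //.
  by ring.
- move=> d lt_d; have lt_dS := ltn_trans lt_d lt_c.
  apply: ls_cell_sum_full; first exact: lt_short.
  have : d.+1%:R * beta ^+ i.+2 <= c%:R * beta ^+ i.+2 by rewrite ler_pM2r // ler_nat.
  by rewrite pos2 // -natr1; lra.
- move=> d /andP[lt_d lt_dS]; apply: ls_cell_sum_empty; first exact: lt_short.
  have : c.+1%:R * beta ^+ i.+2 <= d%:R * beta ^+ i.+2 by rewrite ler_pM2r // ler_nat.
  by rewrite pos2 // -natr1; lra.
Qed.

(** * Summation of the errors over the levels *)

Let W : R := L%:R - 1 + S%:R / 2.

(** The left sides bound, in [ls_top_err], minus the error and the error; the right side is what a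
    single level may contribute. *)
Lemma ls_top_bounds : L%:R + S%:R * beta <= W * (K + 1) + 1 /\
  L%:R + S%:R - 1 + beta ^+ 2 <= W * (K + 1) + 1.
Proof.
have q0 := Sbeta_gt0; have q1 := Sbeta_lt1; have bE := betaE.
have bb := beta_sqr_le; have S1 : 1 <= S%:R :> R by rewrite ler1n.
have L1 : 1 <= L%:R :> R by rewrite ler1n; apply: L_gt0.
have W0 : 0 <= W by rewrite /W; lra.
have SE : S%:R = 1 :> R \/ 2 <= S%:R :> R.
  by case: (S) S_gt0 => [|[|s]] // _; [left | right; rewrite ler_nat].
have le_bq : beta <= S%:R * beta by rewrite ler_peMl // ltW.
have WqE : W * (S%:R * beta) =
    S%:R - (S%:R * beta) * (S%:R * beta) - S%:R * beta + S%:R * (S%:R * beta) / 2.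
  transitivity (S%:R * (L%:R * beta) - S%:R * beta + S%:R * (S%:R * beta) / 2).
    by rewrite /W; field.
  have -> : L%:R * beta = 1 - S%:R * beta ^+ 2 by lra.
  by field.
rewrite /K (_ : S%:R * beta ^+ 2 = S%:R * beta * beta); last by rewrite expr2 mulrA.
have [q sqE] : exists q, S%:R * beta = q by exists (S%:R * beta).
rewrite !sqE in q0 q1 le_bq WqE *.
have rho0 : 0 < 1 + q * beta by rewrite addr_gt0 // mulr_gt0.
set k := _ / _.
have le_k : q <= k * (1 + q * beta).
  rewrite /k invfM mulrA mulrAC mulfVK ?gt_eqF // ler_pdivlMr ?subr_gt0 //.
  by rewrite ler_pM2l // lerD2l lerN2.
have {le_k} le_Wk : W * q <= W * k * (1 + q * beta) by rewrite -mulrA ler_wpM2l.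
rewrite WqE in le_Wk.
have b0 := beta_gt0; have q20 := mulr_gt0 q0 q0; have qb0 := mulr_gt0 q0 b0.
have q2q : q * q <= q by rewrite ler_piMl // ltW.
(* Rounds up [(sqrt 5 - 1) / 2], the largest [beta] with [beta + beta^2 <= 1]. *)
have b62 : beta <= 62 / 100 by nra.
have WkE : W * (k + 1) + 1 = W * k + L%:R + S%:R / 2 by rewrite /W; ring.
rewrite WkE {WkE WqE}; move: (W * k) le_Wk => Wk le_Wk.
have [le1 le2] : q - S%:R / 2 <= Wk /\ S%:R / 2 - 1 + beta ^+ 2 <= Wk; last by split; lra.
split; rewrite -(ler_pM2r rho0); apply: le_trans le_Wk.
  case: SE => [S1E|S2].
    rewrite S1E mul1r in sqE *; rewrite -sqE.
    have := mulr_ge0 (ltW b0) (_ : 0 <= 1 - (beta + beta ^+ 2)); rewrite subr_ge0 => /(_ bb).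
    have := sqr_ge0 (beta - 62 / 100).
    lra.
  apply: (@le_trans _ _ 0).
    by rewrite nmulr_rle0 ?(ltW rho0) //; lra.
  have : 2 * q <= S%:R * q by rewrite ler_pM2r.
  lra.
have -> : (S%:R / 2 - 1 + beta ^+ 2) * (1 + q * beta) =
  S%:R / 2 + q * q / 2 + (beta ^+ 2 - 1) * (1 + q * beta).
  by rewrite -{2}sqE; field.
have b2 : beta ^+ 2 <= 1 by rewrite expr_le1 // ltW.
case: SE => [S1E|S2].
  rewrite S1E mul1r in sqE *; rewrite -sqE.
  have : beta * (beta * beta * beta) <= beta * 1.
    by rewrite ler_pM2l // !mulr_ile1 // ?mulr_ge0 // ltW.
  lra.
have : 2 * q <= S%:R * q by rewrite ler_pM2r.
have : (beta ^+ 2 - 1) * (1 + q * beta) <= beta ^+ 2 - 1.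
  by rewrite ler_neMr //; lra.
have : beta ^+ 2 <= 1 / 2 by nra.
lra.
Qed.

Lemma sum_norm_le (c : nat) (F : nat -> R) (M : R) :
  (forall d, (d < c)%N -> `|F d| <= M) -> `|\sum_(0 <= d < c) F d| <= c%:R * M.
Proof.
move=> leM; rewrite big_mkord; apply: le_trans (ler_norm_sum _ _ _) _.
apply: (@le_trans _ _ (\sum_(d < c) M)); first by apply: ler_sum => d _; apply: leM.
by rewrite sumr_const card_ord mulr_natl.
Qed.

Lemma sum_ge (c : nat) (F : nat -> R) (M : R) :
  (forall d, (d < c)%N -> M <= F d) -> c%:R * M <= \sum_(0 <= d < c) F d.
Proof.
move=> leM; rewrite -{1}(subn0 c) mulr_natl -sumr_const_nat.
by apply: ler_sum_nat => d /andP[_]; apply: leM.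
Qed.

Lemma sum_le (c : nat) (F : nat -> R) (M : R) :
  (forall d, (d < c)%N -> F d <= M) -> \sum_(0 <= d < c) F d <= c%:R * M.
Proof.
move=> leM; rewrite -{2}(subn0 c) mulr_natl -sumr_const_nat.
by apply: ler_sum_nat => d /andP[_]; apply: leM.
Qed.

(** At the level of the leading digit a short piece cannot be charged to two levels, as only one is
    left. Since [N < t n.+1], each piece holds at most one point, and its error is explicit. *)
Lemma ls_top_err n k c x : (t n <= N < t n.+1)%N -> (k < l n)%N -> (c < S)%N ->
  ls_pos n.+2 (child n k (L + c)) <= x <= ls_pos n.+2 (child n k (L + c)) + beta ^+ n.+2 ->
  `|\sum_(0 <= d < L) ls_cell_err n.+1 (child n k d)
    + \sum_(0 <= d < c) ls_cell_err n.+2 (child n k (L + d))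
    + ls_part_err n.+2 (child n k (L + c)) x| <= W * (K + 1) + 1.
Proof.
move=> /andP[le_tN lt_N] lt_k lt_c hx.
have [lt_lo lt_hi] := ls_top_bounds.
have lt_N2 : (N < t n.+2)%N := ltn_trans lt_N (ls_t_ltS _ L_gt0 S_gt0).
have bn : 0 < beta ^+ n by rewrite exprn_gt0.
have b1E : beta ^+ n.+1 = beta ^+ n * beta by rewrite exprSr.
have b2E : beta ^+ n.+2 = beta ^+ n.+1 * beta by rewrite exprSr.
have nb0 : 0 <= N%:R * beta ^+ n.+1 by rewrite mulr_ge0 // exprn_ge0 // ltW.
have ge1 : 1 <= N%:R * beta ^+ n.
  by apply: le_trans (ls_t_ge1 n) _; rewrite mulrC ler_pM2r // ler_nat.
have part_ge : - (N%:R * beta ^+ n.+2) <= ls_part_err n.+2 (child n k (L + c)) x <= 1.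
  have lt_ch : (child n k (L + c) < l n.+2)%N.
    apply: leq_trans (ls_t_leS L_gt0 S_gt0 _).
    by apply: ls_child_ltt => //; rewrite ltn_add2l.
  have := ls_part_err_small lt_N2 lt_ch hx; rewrite ler_norml => /andP[_ ->].
  rewrite andbT /ls_part_err lerBrDr.
  apply: (@le_trans _ _ 0); last first.
    by apply: sumr_ge0 => j _; rewrite mulr_ge0.
  rewrite addrC subr_le0 ler_wpM2l //; move/andP: hx => [_]; lra.
move/andP: part_ge => [p1 p2].
have err1 d : ls_cell_err n.+1 (child n k d) = (child n k d <= N)%:R - N%:R * beta ^+ n.+1.
  by rewrite /ls_cell_err ls_cell_sum_small // mulr1.
have err2 d : ls_cell_err n.+2 (child n k (L + d)) =
    (child n k (L + d) <= N)%:R - N%:R * beta ^+ n.+2.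
  by rewrite /ls_cell_err ls_cell_sum_small // mulr1.
have leb (b : bool) : (0 : R) <= b%:R /\ b%:R <= (1 : R) by case: b; rewrite /= ?lexx ?ler01.
rewrite b2E in p1 err2; rewrite {}b1E in nb0 p1 err1 err2.
set u := N%:R * beta ^+ n in ge1; rewrite !mulrA -/u in nb0 p1 err1 err2.
have c1S : c%:R + 1 <= S%:R :> R by rewrite natr1 ler_nat.
have b0 := beta_gt0; have bb0 : 0 < beta ^+ 2 by rewrite exprn_gt0.
have q0 := Sbeta_gt0; have q1 := Sbeta_lt1; have le_q := Sbeta_le.
have bb1 : beta ^+ 2 < 1 by rewrite expr_lt1 // ltW.
rewrite ler_norml; apply/andP; split; last first.
  apply: le_trans lt_hi.
  have up1 : \sum_(0 <= d < L) ls_cell_err n.+1 (child n k d) <= L%:R * (1 - u * beta).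
    by apply: sum_le => d _; rewrite err1 lerD2r; case: (leb (child n k d <= N)%N).
  have up2 : \sum_(0 <= d < c) ls_cell_err n.+2 (child n k (L + d)) <= c%:R * (1 - u * beta * beta).
    by apply: sum_le => d _; rewrite err2 lerD2r; case: (leb (child n k (L + d) <= N)%N).
  have : L%:R * beta + c%:R * beta ^+ 2 <= u * (L%:R * beta + c%:R * beta ^+ 2).
    by rewrite ler_peMl // addr_ge0 // mulr_ge0 // ltW.
  have : (c%:R + 1) * (1 - beta ^+ 2) <= S%:R * (1 - beta ^+ 2).
    by rewrite ler_pM2r // subr_gt0.
  by move: betaE up1 up2 p2; lra.
apply: le_trans (_ : - (L%:R + S%:R * beta) <= _); first by rewrite lerN2.
have lo2 : c%:R * - (u * beta * beta) <= \sum_(0 <= d < c) ls_cell_err n.+2 (child n k (L + d)).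
  by apply: sum_ge => d _; rewrite err2 lerDr; case: (leb (child n k (L + d) <= N)%N).
(* For [N < l n.+1] one has [u beta <= 1]; otherwise [u beta] may exceed 1, but then every long
   piece contains its left endpoint. *)
have [lt_Nl|le_lN] := ltnP N (l n.+1).
  have lo1 : L%:R * - (u * beta) <= \sum_(0 <= d < L) ls_cell_err n.+1 (child n k d).
    by apply: sum_ge => d _; rewrite err1 lerDr; case: (leb (child n k d <= N)%N).
  have le_u : u * beta <= 1.
    apply: le_trans (ls_l_le1 n.+1); rewrite /u -mulrA -exprSr mulrC ler_pM2l ?exprn_gt0 //.
    by rewrite ler_nat ltnW.
  have : L%:R * (u * beta) <= L%:R * 1 by rewrite ler_wpM2l.
  have : (c%:R + 1) * (u * beta * beta) <= S%:R * (1 * beta).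
    by rewrite ler_pM ?mulr_ge0 ?addr_ge0 ?ler_pM2r // ltW.
  by move: lo1 lo2 p1; lra.
have le_u : u * beta <= 1 + S%:R * beta * (1 - beta).
  apply: le_trans (ls_t_le n.+1); rewrite /u -mulrA -exprSr mulrC ler_pM2l ?exprn_gt0 //.
  by rewrite ler_nat ltnW.
have lo1 : L%:R * - (S%:R * beta * (1 - beta)) <= \sum_(0 <= d < L) ls_cell_err n.+1 (child n k d).
  apply: sum_ge => d lt_d; rewrite err1.
  have -> : (child n k d <= N)%N.
    by apply: leq_trans le_lN; apply: ltnW; apply: ls_child_long.
  by rewrite /=; lra.
have le_cu : (c%:R + 1) * (u * beta * beta) <= S%:R * beta * (1 + S%:R * beta * (1 - beta)).
  apply: (@le_trans _ _ (S%:R * ((1 + S%:R * beta * (1 - beta)) * beta))).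
    by rewrite ler_pM ?mulr_ge0 ?addr_ge0 ?ler_pM2r // ltW.
  by rewrite le_eqVlt; apply/orP; left; apply/eqP; ring.
have SL : S%:R * beta <= L%:R * beta by rewrite ler_pM2r // ler_nat.
have L0 : 0 <= L%:R :> R by [].
move: (S%:R * beta) q0 q1 le_q SL lo1 le_cu => q q0 q1 le_q SL lo1 le_cu.
have h1 := ler_wpM2l L0 le_q; have h2 := ler_wpM2l (ltW q0) SL.
have h3 : 0 <= (L%:R + q) * q * beta by rewrite !mulr_ge0 ?addr_ge0 // ltW.
by move: lo1 lo2 p1; lra.
Qed.

Lemma ls_part_err_le n i k x : (t n <= N < t n.+1)%N -> (k < l i)%N ->
  ls_pos i k <= x <= ls_pos i k + beta ^+ i ->
  `|ls_part_err i k x| <= W * (K + 1) * (n.+1 - i)%:R + 1.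
Proof.
move=> hN; have /andP[_ lt_N] := hN; move: i k.
have small i k : (n < i)%N -> (k < l i)%N -> ls_pos i k <= x <= ls_pos i k + beta ^+ i ->
    `|ls_part_err i k x| <= W * (K + 1) * (n.+1 - i)%:R + 1.
  move=> lt_ni lt_k hx; have -> : (n.+1 - i = 0)%N by lia.
  rewrite mulr0 add0r; apply: ls_part_err_small => //.
  by apply: leq_trans lt_N _; apply: ls_t_mono.
have S1 : 1 <= S%:R :> R by rewrite ler1n.
have L1 : 1 <= L%:R :> R by rewrite ler1n; apply: L_gt0.
have K0 : 0 <= K + 1 := le_trans (normr_ge0 _) (@ls_cell_err_le 0 0 isT).
apply: (@down_ind2 n.+1 (fun i => forall k, _ -> _ -> _)) => [i lt_ni k|i IH1 IH2 k lt_k hx].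
  exact: small.
have [lt_ni|le_in] := ltnP n i; first exact: small.
have lt_short d : (d < S)%N -> (child i k (L + d) < l i.+2)%N.
  move=> lt_d; apply: leq_trans (ls_t_leS L_gt0 S_gt0 _).
  by apply: ls_child_ltt => //; rewrite ltn_add2l.
have [[c lt_c [hxc ->]]|[c lt_c [hxc E]]] := ls_part_err_children lt_k hx.
  apply: le_trans (ler_normD _ _) _.
  have := IH1 _ (ls_child_long L_gt0 S_gt0 lt_k lt_c) hxc.
  rewrite -[(n.+1 - i)%N]subnSK ?ltnS //.
  have : `|\sum_(0 <= d < c) ls_cell_err i.+1 (child i k d)| <= c%:R * (K + 1).
    apply: sum_norm_le => d lt_d; apply: ls_cell_err_le; apply: ls_child_long => //.
    exact: ltn_trans lt_d lt_c.
  have : c%:R * (K + 1) <= W * (K + 1).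
    rewrite ler_wpM2r // /W; have : c%:R + 1 <= L%:R :> R by rewrite natr1 ler_nat.
    lra.
  rewrite -natr1 mulrDr mulr1; lra.
move: le_in; rewrite leq_eqVlt => /predU1P[eq_in|lt_in].
  have -> : (n.+1 - i = 1)%N by rewrite eq_in subSnn.
  by rewrite E mulr1; subst i; apply: ls_top_err.
rewrite E; apply: le_trans (ler_normD _ _) _.
have h1 := IH2 _ (lt_short _ lt_c) hxc.
have h2 : `|\sum_(0 <= d < L) ls_cell_err i.+1 (child i k d)| <= L%:R * (K + 1).
  by apply: sum_norm_le => d lt_d; apply: ls_cell_err_le; apply: ls_child_long.
have h3 : `|\sum_(0 <= d < c) ls_cell_err i.+2 (child i k (L + d))| <= c%:R * (K + 1).
  apply: sum_norm_le => d lt_d; apply: ls_cell_err_le; apply: lt_short.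
  exact: ltn_trans lt_d lt_c.
have h4 := le_trans (ler_normD _ _) (lerD h2 h3).
(* A short piece uses up two levels, so at most [L + S - 1] intervals are charged to
   [2 W = 2 L + S - 2]. *)
have h5 : (L%:R + c%:R) * (K + 1) <= 2 * W * (K + 1).
  rewrite ler_wpM2r // /W; have : c%:R + 1 <= S%:R :> R by rewrite natr1 ler_nat.
  lra.
rewrite -[(n.+1 - i)%N]subnSK ?ltnS 1?ltnW // -[(n.+1 - i.+1)%N]subnSK ?ltnS //.
by rewrite -!natr1; move: h1 h4 h5; lra.
Qed.

Lemma ls_star_err n x : (t n <= N < t n.+1)%N -> 0 <= x <= 1 ->
  `|\sum_(0 <= j < N.+1) below x j - N%:R * x| <= W * (K + 1) * n.+1%:R + 1.
Proof.
move=> hN hx; have := @ls_part_err_le n 0 0 x hN isT.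
rewrite /= add0r expr0 subn0 /ls_part_err /= subr0 => /(_ hx).
have -> // : ls_cell_sum 0 0 (below x) = \sum_(0 <= j < N.+1) below x j.
apply: eq_bigr => j _.
have := ls_anc_lt L_gt0 S_gt0 0 j; rewrite ltnS leqn0 => /eqP ->.
by rewrite eqxx mul1r.
Qed.

Lemma ls_interval_err n a b : (t n <= N < t n.+1)%N -> 0 <= a -> a < b -> b <= 1 ->
  `|\sum_(1 <= j < N.+1) \1_(`[a, b[%classic : set R) (ls_point L S beta j)
    - N%:R * (b - a)| <= 2 * W * (K + 1) * n.+1%:R + 2.
Proof.
move=> hN a0 ab b1.
have S1 : 1 <= S%:R :> R by rewrite ler1n.
have L1 : 1 <= L%:R :> R by rewrite ler1n; apply: L_gt0.
have K0 : 0 <= K + 1 := le_trans (normr_ge0 _) (@ls_cell_err_le 0 0 isT).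
have W0 : 0 <= W * (K + 1) * n.+1%:R by rewrite !mulr_ge0 // /W; lra.
have -> : \sum_(1 <= j < N.+1) \1_(`[a, b[%classic : set R) (ls_point L S beta j) =
    \sum_(1 <= j < N.+1) below b j - \sum_(1 <= j < N.+1) below a j.
  rewrite -sumrB; apply: eq_big_nat => j /andP[j0 _].
  rewrite ls_pointE // indicE /below; set y := ls_pos j j.
  rewrite (_ : (y \in _) = (a <= y < b)); last by rewrite mem_setE in_itv.
  have [lt_ya|le_ay] := ltP y a; last by rewrite subr0.
  by rewrite (lt_trans lt_ya ab) subrr.
have hb := @ls_star_err n b hN; have ha := @ls_star_err n a hN.
rewrite big_ltn // in hb; rewrite big_ltn // in ha.
have {}hb := hb _; rewrite (ltW (le_lt_trans a0 ab)) b1 in hb; have {hb} := hb isT.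
rewrite a0 (le_trans (ltW ab) b1) in ha; have {ha} := ha isT.
have -> : below b 0 = 1 by rewrite /below /= (le_lt_trans a0 ab).
rewrite {1}/below /= !ler_norml.
(* For [a > 0] index 0 lies in both [[0, a)] and [[0, b)] and cancels. For [a = 0] it is a surplus
   of 1, affordable because only the error at [b] occurs. *)
move: a0; rewrite le_eqVlt => /predU1P[<-|a_gt0].
  rewrite ltxx /=.
  have -> : \sum_(1 <= j < N.+1) below 0 j = 0.
    apply: big1 => j _; rewrite /below ltNge.
    suff -> : 0 <= ls_pos j j by [].
    have := @ls_cell 0 j 0 isT; rewrite /= => h.
    have /h /andP[] // : anc 0 j = 0%N.
    by have := ls_anc_lt L_gt0 S_gt0 0 j; rewrite ltnS leqn0 => /eqP.
  by move=> _ /andP[h1 h2]; apply/andP; split; lra.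
by rewrite a_gt0 /= => /andP[h1 h2] /andP[h3 h4]; apply/andP; split; lra.
Qed.

End Points.

(** * Comparison with the constants of the theorem *)

Section Bound.
Local Open Scope ring_scope.
Variables (R : realType) (L S : nat) (beta : R).
Hypothesis S_gt0 : (0 < S)%N.
Hypotheses (beta_gt0 : 0 < beta) (beta_lt1 : beta < 1).
Hypothesis betaE : S%:R * beta ^+ 2 + L%:R * beta = 1.

(** The square root is the difference of the roots [1 / beta] and [- S beta] of [X^2 - L X - S]. *)
Lemma sqrt_disc : Num.sqrt (L%:R ^+ 2 + 4 * S%:R) = beta^-1 + S%:R * beta.
Proof.
have b0 : beta != 0 by rewrite gt_eqF.
have -> : L%:R = beta^-1 - S%:R * beta.
  by apply: (mulIf b0); rewrite mulrBl mulVf //; move: betaE; lra.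
rewrite (_ : _ + _ = (beta^-1 + S%:R * beta) ^+ 2); last by field.
by rewrite sqrtr_sqr ger0_norm // addr_ge0 ?mulr_ge0 ?invr_ge0 // ltW.
Qed.

(** The left side equals [|tau1|]. *)
Lemma Rtilde_ge :
  S%:R * beta * (1 - beta) / (1 + S%:R * beta ^+ 2) <= Rtilde R L S.
Proof.
rewrite /Rtilde le_max; apply/orP; left; rewrite /tau1 sqrt_disc.
have b0 : beta != 0 by rewrite gt_eqF.
have rho0 : 0 < 1 + S%:R * beta ^+ 2.
  by rewrite addr_gt0 // mulr_gt0 ?exprn_gt0 ?ltr0n.
have -> : L%:R = beta^-1 - S%:R * beta.
  by apply: (mulIf b0); rewrite mulrBl mulVf //; move: betaE; lra.
set g := _ / (1 + _).
rewrite [X in `|X|](_ : _ = - g); first by rewrite normrN ler_norm.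
by rewrite /g; field; rewrite (gt_eqF rho0) b0.
Qed.

(** Logarithm of [N beta^n >= t_n beta^n >= 1]. *)
Lemma ls_level_le N n : (ls_t L S n <= N)%N -> (0 < N)%N ->
  n%:R <= ln N%:R / `|ln beta|.
Proof.
move=> le_tN N_gt0; have ln_b : ln beta < 0 by rewrite ln_lt0 // beta_gt0.
rewrite ltr0_norm // ler_pdivlMr ?oppr_gt0 //.
have bn : 0 < beta ^+ n by rewrite exprn_gt0.
have : 1 <= N%:R * beta ^+ n.
  apply: le_trans (ls_t_ge1 S_gt0 beta_gt0 beta_lt1 betaE n) _.
  by rewrite mulrC ler_pM2r // ler_nat.
move/ln_ge0; rewrite lnM ?posrE ?ltr0n // lnXn // -mulr_natl.
lra.
Qed.

End Bound.

Local Open Scope ring_scope.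

Theorem theorem1 (R : realType) (L S : nat) (beta : R)
  (hS : (1 <= S)%N) (hLS : (S <= L)%N)
  (hbeta0 : 0 < beta) (hbeta1 : beta < 1)
  (hbeta : S%:R * beta ^+ 2 + L%:R * beta = 1)
  (N : nat) (hN : (1 <= N)%N) :
  discrepancy (ls_point L S beta) N <=
    ln N%:R / (N%:R * `|ln beta|)
      * (2 * L%:R + S%:R - 2) * (Rtilde R L S / (1 - S%:R * beta) + 1)
    + Bconst L S beta / N%:R.
Proof.
have L_gt0 : (0 < L)%N := leq_trans hS hLS.
have top := ls_topP L_gt0 hS hN; set n := ls_top L S N in top.
have /andP[le_tN _] := top.
have q1 := Sbeta_lt1 hS hLS hbeta0 hbeta.
have N0 : 0 < N%:R :> R by rewrite ltr0n.
have le_n := ls_level_le hS hbeta0 hbeta1 hbeta le_tN hN.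
have C0 : 0 <= 2 * L%:R + S%:R - 2 :> R.
  have : 1 <= S%:R :> R by rewrite ler1n.
  have : 1 <= L%:R :> R by rewrite ler1n.
  lra.
have le_K : S%:R * beta * (1 - beta) / ((1 + S%:R * beta ^+ 2) * (1 - S%:R * beta))
    <= Rtilde R L S / (1 - S%:R * beta).
  rewrite invfM mulrA ler_wpM2r ?invr_ge0 ?subr_ge0 ?(ltW q1) //.
  exact: Rtilde_ge.
apply: ge_sup.
  by exists `|N%:R^-1 * (\sum_(1 <= j < N.+1)
    \1_(`[0, 1[%classic : set R) (ls_point L S beta j)) - (1 - 0)|; exists 0, 1; split.
move=> _ [a [b [a0 ab b1 ->]]].
have := ls_interval_err hS hLS hbeta0 hbeta1 hbeta top a0 ab b1.
set sum := \sum_(1 <= j < N.+1) _ => le_err.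
have -> : N%:R^-1 * sum - (b - a) = (sum - N%:R * (b - a)) / N%:R.
  by field; rewrite gt_eqF.
rewrite normrM normfV (gtr0_norm N0) ler_pdivrMr // mulrDl mulfVK ?gt_eqF //.
apply: (le_trans le_err); rewrite /Bconst {le_err sum}.
move: le_K; set K0 := _ / (_ * _); set K := _ / (1 - _) => le_K.
have -> : ln N%:R / (N%:R * `|ln beta|) * (2 * L%:R + S%:R - 2) * (K + 1) * N%:R
    = ln N%:R / `|ln beta| * ((2 * L%:R + S%:R - 2) * (K + 1)).
  rewrite invfM; set v := `|ln beta|^-1; field; by rewrite gt_eqF.
have le_C : (2 * L%:R + S%:R - 2) * (K0 + 1) <= (2 * L%:R + S%:R - 2) * (K + 1).
  by rewrite ler_wpM2l // lerD2r.
have K0_ge0 : 0 <= K0.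
  have /ltW q0 := Sbeta_gt0 hS hbeta0.
  rewrite divr_ge0 ?mulr_ge0 ?subr_ge0 ?addr_ge0 ?mulr_ge0 ?exprn_ge0 //; exact: ltW.
have C'0 : 0 <= (2 * L%:R + S%:R - 2) * (K + 1).
  by apply: le_trans le_C; rewrite mulr_ge0 // addr_ge0.
have h1 := ler_wpM2l (ler0n R n.+1) le_C.
have h2 := ler_wpM2r C'0 le_n.
(* Of the factor [n + 1], [n] yields the logarithmic term, and 1 goes into [Bconst] with the 2 from
   the two endpoints. *)
by move: h1; rewrite -natr1; move: h2; lra.
Qed.
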